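(* Let $0<p<q\le 1$, $\tau\ge 0$, $0\le\eta<1$, $\kappa,\xi\in\mathbb{N}_0$, $0\le\rho<1$, and let $\varphi\in\mathcal{P}_{p,q}^{\xi,\kappa}(\tau,\eta)$, $\varphi(z)=z-\sum_{\nu=2}^{\infty}c_\nu z^\nu$ with $c_\nu\ge0$. Then $\varphi$ is close-to-convex of order $\rho$ in $|z|<r_1$, where $$r_1:=\inf_{\nu\ge2}\left(\frac{(1-\rho)\nu^{-1}[\nu]_{p,q}^{\kappa}(\nu-\eta)\big\{1+([\nu]_{p,q}-1)\tau\big\}[1+(\nu-1)\tau]^{\xi}}{1-\eta}\right)^{1/(\nu-1)} .$$ The result is sharp, with extremal function $$\varphi(z)=z-\frac{1-\eta}{[\nu]_{p,q}^{\kappa}(\nu-\eta)\big\{1+([\nu]_{p,q}-1)\tau\big\}[1+(\nu-1)\tau]^{\xi}}\,z^{\nu}\qquad(\nu\ge2).$$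
   Context: $\Omega=\{z\in\mathbb{C}:|z|<1\}$; $\mathbb{N}_0=\mathbb{N}\cup\{0\}$. $\mathcal{A}$ is the class of analytic functions $\varphi$ on $\Omega$ with $\varphi(0)=0$, $\varphi'(0)=1$, so $\varphi(z)=z+\sum_{\nu\ge2}c_\nu z^\nu$. For $0<p<q\le1$, $[\nu]_{p,q}=\frac{p^\nu-q^\nu}{p-q}=\sum_{j=0}^{\nu-1}p^{\nu-1-j}q^{j}$. For $\varphi\in\mathcal{A}$, $\tau\ge0$, $\kappa,\xi\in\mathbb{N}_0$ define the operator $$\Upsilon_{\tau,p,q}^{\xi,\kappa}\varphi(z)=z+\sum_{\nu=2}^{\infty}[\nu]_{p,q}^{\kappa}[1+(\nu-1)\tau]^{\xi}c_\nu z^\nu .$$ For $0\le\eta<1$, $\tau\ge0$, $\mathcal{Q}_{p,q}^{\xi,\kappa}(\tau,\eta)$ is the class of $\varphi\in\mathcal{A}$ such that for all $z\in\Omega$ $$\operatorname{Re}\left\{\frac{(1-\tau)z\big(\Upsilon_{\tau,p,q}^{\xi,\kappa}\varphi(z)\big)'+\tau z\big(\Upsilon_{\tau,p,q}^{\xi,\kappa+1}\varphi(z)\big)'}{(1-\tau)\Upsilon_{\tau,p,q}^{\xi,\kappa}\varphi(z)+\tau\Upsilon_{\tau,p,q}^{\xi,\kappa+1}\varphi(z)}\right\}>\eta .$$ $\mathcal{T}$ is the subclass of $\mathcal{A}$ of functions of the form $\varphi(z)=z-\sum_{\nu=2}^{\infty}c_\nu z^\nu$ with all $c_\nu\ge0$,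 and $\mathcal{P}_{p,q}^{\xi,\kappa}(\tau,\eta)=\mathcal{Q}_{p,q}^{\xi,\kappa}(\tau,\eta)\cap\mathcal{T}$. Close-to-convex of order $\rho$ in $|z|<r$ means $\operatorname{Re}\varphi'(z)>\rho$ for $|z|<r$. ''Sharp'' means that the radius cannot be replaced by a larger one valid for all functions in the class.
   Formalization: The formal theorem assumes 1+([ν]_{p,q}-1)τ>0 for all ν≥2, i.e. τ≤1 or q=1; for τ>1 and q<1 this factor is negative for all large ν, so r_1 would need even roots of negative numbers and is undefined. *)

(* Defs.v *)
From Stdlib Require Import Reals ClassicalEpsilon.
From Coquelicot Require Import Coquelicot.

Open Scope R_scope.

Definition disc (z : C) : Prop := Cmod z < 1.

(* "Analytic on the disc" is complex differentiability at every point of the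
   disc: [ex_derive] is taken over the field [C_AbsRing], not over [R].
   Functions have type [C -> C]; values outside the disc are irrelevant.
   Pitfall: Coquelicot's [C_derive f z] is the complex derivative when [f] is
   complex differentiable at [z] ([is_C_derive_unique]); otherwise its value is
   not meaningful. *)
Definition classA (phi : C -> C) : Prop :=
  (forall z : C, disc z ->
     @ex_derive C_AbsRing C_NormedModule phi z) /\
  phi (RtoC 0) = RtoC 0 /\
  C_derive phi (RtoC 0) = RtoC 1.

Definition tail_expansion (c : nat -> C) (z s : C) : Prop :=
  @is_series C_AbsRing C_NormedModule
    (fun n => (c (n + 2)%nat * z ^ (n + 2))%C) s.

(* The Taylor coefficients c_nu, nu >= 2, of phi in the class A: the sequence
   with phi(z) = z + sum_{nu >= 2} c_nu z^nu on the disc. It exists and is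
   unique (for indices >= 2; the values at 0 and 1 are never used) for every
   phi in the class A. *)
Definition coeff (phi : C -> C) : nat -> C :=
  epsilon (inhabits (fun _ : nat => RtoC 0))
    (fun c => forall z : C, disc z -> tail_expansion c z (phi z - z)%C).

Definition CSeries (a : nat -> C) : C :=
  iota (fun s : C_CompleteNormedModule =>
          @is_series C_AbsRing C_NormedModule a s).

Definition pq_bracket (p q : R) (nu : nat) : R := (p ^ nu - q ^ nu) / (p - q).

Definition Upsilon (xi kappa : nat) (tau p q : R) (phi : C -> C) (z : C) : C :=
  (z + CSeries (fun n =>
         RtoC (pq_bracket p q (n + 2) ^ kappa *
               (1 + (INR (n + 2) - 1) * tau) ^ xi)
         * coeff phi (n + 2)%nat * z ^ (n + 2)))%C.

Definition Q_num (xi kappa : nat) (tau p q : R) (phi : C -> C) (z : C) : C :=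
  (RtoC (1 - tau) * z * C_derive (Upsilon xi kappa tau p q phi) z +
   RtoC tau * z * C_derive (Upsilon xi (kappa + 1) tau p q phi) z)%C.

Definition Q_den (xi kappa : nat) (tau p q : R) (phi : C -> C) (z : C) : C :=
  (RtoC (1 - tau) * Upsilon xi kappa tau p q phi z +
   RtoC tau * Upsilon xi (kappa + 1) tau p q phi z)%C.

(* At z = 0 the quotient is 0/0 with a removable singularity and value 1 > eta,
   so the condition is only imposed at the other points of the disc (Coquelicot's
   0/0 = 0 would wrongly fail it). Elsewhere the quotient has to be defined. *)
Definition classQ (xi kappa : nat) (tau eta p q : R) (phi : C -> C) : Prop :=
  classA phi /\
  forall z : C, disc z -> z <> RtoC 0 ->
    Q_den xi kappa tau p q phi z <> RtoC 0 /\
    Re (Q_num xi kappa tau p q phi z / Q_den xi kappa tau p q phi z)%C > eta.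

Definition classT (phi : C -> C) : Prop :=
  classA phi /\
  exists c : nat -> R,
    (forall nu : nat, (2 <= nu)%nat -> 0 <= c nu) /\
    forall z : C, disc z ->
      tail_expansion (fun nu => RtoC (c nu)) z (z - phi z)%C.

Definition classP (xi kappa : nat) (tau eta p q : R) (phi : C -> C) : Prop :=
  classQ xi kappa tau eta p q phi /\ classT phi.

Definition close_to_convex (rho r : R) (phi : C -> C) : Prop :=
  forall z : C, Cmod z < r ->
    @ex_derive C_AbsRing C_NormedModule phi z /\ Re (C_derive phi z) > rho.

Definition weight (xi kappa : nat) (tau eta p q : R) (nu : nat) : R :=
  pq_bracket p q nu ^ kappa * (INR nu - eta) *
  (1 + (pq_bracket p q nu - 1) * tau) * (1 + (INR nu - 1) * tau) ^ xi.

(* [Rpower x y] is the real power x^y only for x > 0. *)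
Definition r1 (xi kappa : nat) (tau eta rho p q : R) : R :=
  real (Glb_Rbar (fun x => exists nu : nat, (2 <= nu)%nat /\
    x = Rpower ((1 - rho) * / INR nu * weight xi kappa tau eta p q nu / (1 - eta))
               (1 / (INR nu - 1)))).

Definition extremal (xi kappa : nat) (tau eta p q : R) (nu : nat) (z : C) : C :=
  (z - RtoC ((1 - eta) / weight xi kappa tau eta p q nu) * z ^ nu)%C.

(* Main.v *)
(* On the real segment (0, 1) numerator and denominator of the defining quotient
   are real, and the denominator d(x) = x - sum b_nu x^nu, having no zero and
   slope 1 at 0, is positive there.  Hence the condition says
   sum (nu - eta) b_nu x^nu < (1 - eta) x, and x -> 1 yields the coefficient bound
   sum w_nu c_nu <= 1 - eta, where w_nu = (nu - eta) b_nu / c_nu is the weight.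
   For |z| <= r = t r1 with t < 1 one has nu r^(nu-1) <= t (1 - rho) w_nu / (1 - eta),
   so the bound makes z - phi z Lipschitz with constant t (1 - rho) < 1 - rho.
   Since the weights grow at most polynomially, r1 <= 1.  For sharpness, the
   derivative of the nu-th extremal function equals rho at the real point which
   is the nu-th root occurring in r1. *)

From Stdlib Require Import Reals Ranalysis5 Lra Lia ClassicalEpsilon.
From Coquelicot Require Import Coquelicot.
Require Import Defs.

Open Scope R_scope.

(** * Complex derivatives and series *)

Lemma is_C_derive_eps (f : C -> C) (z l : C) :
  @is_derive C_AbsRing C_NormedModule f z l <->
  forall eps : R, 0 < eps -> exists d : R, 0 < d /\
    forall w : C, Cmod (w - z) < d ->
      Cmod (f w - f z - l * (w - z)) <= eps * Cmod (w - z).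
Proof.
split.
- intros [_ H] eps Heps.
  destruct (H z (fun P HP => HP) (mkposreal eps Heps)) as [d Hd].
  exists d; split; [apply cond_pos|]; intros w Hw.
  specialize (Hd w Hw).
  replace (f w - f z - l * (w - z))%C
    with (@minus C_NormedModule (@minus C_NormedModule (f w) (f z))
            (@scal C_AbsRing C_NormedModule (@minus C_AbsRing w z) l)).
  exact Hd.
  unfold minus, scal, plus, opp; simpl; unfold mult; simpl. ring.
- intros H; split.
  + apply is_linear_scal_l.
  + intros x Hx eps.
    assert (Ex : z = x) 
      by (apply (@is_filter_lim_locally_unique C_AbsRing (AbsRing_NormedModule C_AbsRing)); exact Hx).
    subst x.
    destruct (H eps (cond_pos eps)) as [d [Hd H']].
    exists (mkposreal d Hd); intros w Hw.
    specialize (H' w Hw).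
    replace (f w - f z - l * (w - z))%C
      with (@minus C_NormedModule (@minus C_NormedModule (f w) (f z))
            (@scal C_AbsRing C_NormedModule (@minus C_AbsRing w z) l)) in H'.
    exact H'.
    unfold minus, scal, plus, opp; simpl; unfold mult; simpl. ring.
Qed.

Lemma is_C_derive_mul_id (f : C -> C) (z l : C) :
  @is_derive C_AbsRing C_NormedModule f z l ->
  @is_derive C_AbsRing C_NormedModule (fun w => w * f w)%C z (f z + z * l)%C.
Proof.
rewrite !is_C_derive_eps; intros H eps Heps.
pose proof (Cmod_ge_0 z) as Hz; pose proof (Cmod_ge_0 l) as Hl.
set (e := eps / (2 * (Cmod z + 1))).
assert (He : 0 < e) by (apply Rdiv_lt_0_compat; lra).
destruct (H e He) as [d [Hd H']].
exists (Rmin d (Rmin 1 (eps / (2 * (Cmod l + 1))))); split.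
{ repeat apply Rmin_glb_lt; try lra; apply Rdiv_lt_0_compat; lra. }
intros w Hw.
assert (W1 : Cmod (w - z) < d) by (eapply Rlt_le_trans; [exact Hw | apply Rmin_l]).
assert (W2 : Cmod (w - z) < 1)
  by (eapply Rlt_le_trans; [exact Hw | eapply Rle_trans; [apply Rmin_r | apply Rmin_l]]).
assert (W3 : Cmod (w - z) < eps / (2 * (Cmod l + 1)))
  by (eapply Rlt_le_trans; [exact Hw | eapply Rle_trans; [apply Rmin_r | apply Rmin_r]]).
specialize (H' w W1).
replace (w * f w - z * f z - (f z + z * l) * (w - z))%C
  with (w * (f w - f z - l * (w - z)) + (w - z) * l * (w - z))%C by ring.
eapply Rle_trans; [apply Cmod_triangle|].
rewrite !Cmod_mult.
assert (Ww : Cmod w <= Cmod z + 1).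
{ replace w with (z + (w - z))%C by ring.
  eapply Rle_trans; [apply Cmod_triangle|]; lra. }
pose proof (Cmod_ge_0 (w - z)) as P.
assert (K1 : Cmod w * Cmod (f w - f z - l * (w - z)) <= (Cmod z + 1) * (e * Cmod (w - z))).
{ apply Rmult_le_compat; try apply Cmod_ge_0; assumption. }
replace ((Cmod z + 1) * (e * Cmod (w - z))) with (eps / 2 * Cmod (w - z)) in K1
  by (unfold e; field; lra).
assert (K2 : Cmod (w - z) * Cmod l <= eps / 2).
{ apply Rle_trans with (eps / (2 * (Cmod l + 1)) * (Cmod l + 1)).
  - apply Rmult_le_compat; lra.
  - right; field; lra. }
assert (K3 := Rmult_le_compat_r _ _ _ P K2).
lra.
Qed.

Lemma is_C_derive_monomial (b : C) (n : nat) (z : C) :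
  @is_derive C_AbsRing C_NormedModule (fun w => b * w ^ n)%C z
    (b * INR n * z ^ (n - 1))%C.
Proof.
induction n as [|n IH].
- apply is_derive_ext with (fun _ => b).
  { intros t; simpl. change (b = (b * 1)%C); ring. }
  replace (b * INR 0 * z ^ (0 - 1))%C with (@zero C_NormedModule).
  apply @is_derive_const.
  change (RtoC 0 = (b * RtoC 0 * z ^ 0)%C); ring.
- apply is_derive_ext with (fun w => w * (b * w ^ n))%C.
  { intros t; rewrite Cpow_S. change ((t * (b * t ^ n))%C = (b * (t * t ^ n))%C); ring. }
  replace (b * INR (S n) * z ^ (S n - 1))%C
    with (b * z ^ n + z * (b * INR n * z ^ (n - 1)))%C.
  apply (is_C_derive_mul_id (fun w => b * w ^ n)%C); exact IH.
  replace (S n - 1)%nat with n by lia.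
  rewrite S_INR, RtoC_plus.
  destruct n as [|n].
  + simpl. ring.
  + replace (S n - 1)%nat with n by lia. rewrite Cpow_S. ring.
Qed.

Lemma is_C_derive_id_sub_monomial (b : C) (n : nat) (z : C) :
  @is_derive C_AbsRing C_NormedModule (fun w => w - b * w ^ n)%C z
    (1 - b * INR n * z ^ (n - 1))%C.
Proof.
apply (@is_derive_minus C_AbsRing C_NormedModule (fun w => w) (fun w => b * w ^ n)%C).
- apply is_C_derive_eps; intros eps Heps; exists 1; split; [lra|]; intros w _.
  replace (w - z - 1 * (w - z))%C with (RtoC 0) by ring.
  rewrite Cmod_0. apply Rmult_le_pos; [lra | apply Cmod_ge_0].
- apply is_C_derive_monomial.
Qed.

Lemma Cpow_sub_bound (z w : C) (M : R) (n : nat) :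
  Cmod z <= M -> Cmod w <= M ->
  Cmod (w ^ S n - z ^ S n) <= INR (S n) * M ^ n * Cmod (w - z).
Proof.
intros Hz Hw.
assert (HM : 0 <= M) by (eapply Rle_trans; [apply Cmod_ge_0 | exact Hz]).
induction n as [|n IH].
- rewrite !Cpow_1_r; simpl; lra.
- rewrite (Cpow_S w (S n)), (Cpow_S z (S n)).
  replace (w * w ^ S n - z * z ^ S n)%C
    with (w * (w ^ S n - z ^ S n) + (w - z) * z ^ S n)%C by ring.
  eapply Rle_trans; [apply Cmod_triangle|].
  rewrite !Cmod_mult, Cmod_pow.
  assert (K1 : Cmod w * Cmod (w ^ S n - z ^ S n) <= M * (INR (S n) * M ^ n * Cmod (w - z))).
  { apply Rmult_le_compat; try apply Cmod_ge_0; assumption. }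
  assert (K2 : Cmod z ^ S n <= M ^ S n) by (apply pow_incr; split; [apply Cmod_ge_0 | exact Hz]).
  assert (K3 := Rmult_le_compat_l _ _ _ (Cmod_ge_0 (w - z)) K2).
  rewrite (S_INR (S n)).
  simpl pow in *. lra.
Qed.

Lemma is_series_Re (a : nat -> C) (s : C) :
  @is_series C_AbsRing C_NormedModule a s ->
  is_series (fun n => Re (a n)) (Re s).
Proof.
intros H; apply filterlim_locally; intros eps.
assert (H' := proj1 (filterlim_locally _ _) H eps).
revert H'; apply filter_imp; intros n [Hn _].
assert (E : sum_n (fun k => Re (a k)) n = Re (@sum_n C_NormedModule a n)).
{ clear; induction n as [|n IH].
  - now rewrite !sum_O.
  - rewrite !sum_Sn, IH. reflexivity. }
exact (eq_ind_r (fun x => ball (Re s) eps x) Hn E).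
Qed.

Lemma is_series_Im (a : nat -> C) (s : C) :
  @is_series C_AbsRing C_NormedModule a s ->
  is_series (fun n => Im (a n)) (Im s).
Proof.
intros H; apply filterlim_locally; intros eps.
assert (H' := proj1 (filterlim_locally _ _) H eps).
revert H'; apply filter_imp; intros n [_ Hn].
assert (E : sum_n (fun k => Im (a k)) n = Im (@sum_n C_NormedModule a n)).
{ clear; induction n as [|n IH].
  - now rewrite !sum_O.
  - rewrite !sum_Sn, IH. reflexivity. }
exact (eq_ind_r (fun x => ball (Im s) eps x) Hn E).
Qed.

Lemma is_series_RtoC (a : nat -> R) (s : R) :
  is_series a s ->
  @is_series C_AbsRing C_NormedModule (fun n => RtoC (a n)) (RtoC s).
Proof.
intros H; apply filterlim_locally; intros eps.
assert (H' := proj1 (filterlim_locally _ _) H eps).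
revert H'; apply filter_imp; intros n Hn.
assert (E : @sum_n C_NormedModule (fun k => RtoC (a k)) n = RtoC (sum_n a n)).
{ clear; induction n as [|n IH].
  - now rewrite !sum_O.
  - rewrite !sum_Sn, IH. symmetry. apply RtoC_plus. }
refine (eq_ind_r (fun x => @ball C_UniformSpace (RtoC s) eps x) _ E).
split; [exact Hn | apply ball_center].
Qed.

Lemma is_series_single {K : AbsRing} {V : NormedModule K} (a : nat -> V) (k : nat) :
  (forall n, n <> k -> a n = zero) -> is_series a (a k).
Proof.
intros H.
assert (P : forall m, (m < k)%nat -> sum_n a m = zero).
{ induction m as [|m IH]; intros Hm.
  - rewrite sum_O; apply H; lia.
  - rewrite sum_Sn, IH, (H (S m)), plus_zero_l by lia; reflexivity. }
assert (Q : forall m, sum_n a (k + m) = a k).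
{ induction m as [|m IH].
  - rewrite Nat.add_0_r. destruct k as [|k]; [apply sum_O|].
    rewrite sum_Sn, P, plus_zero_l by lia; reflexivity.
  - rewrite Nat.add_succ_r, sum_Sn, IH, (H (S (k + m))), plus_zero_r by lia; reflexivity. }
apply filterlim_ext_loc with (fun _ => a k).
- exists k; intros n Hn. replace n with (k + (n - k))%nat by lia. now rewrite Q.
- apply filterlim_const.
Qed.

Lemma CSeries_unique (a : nat -> C) (s : C) :
  @is_series C_AbsRing C_NormedModule a s -> CSeries a = s.
Proof.
intros H.
apply (@iota_filterlim_locally C_AbsRing C_CompleteNormedModule nat eventually
         (Proper_StrongProper _ eventually_filter) (@sum_n C_NormedModule a) s H).
Qed.

(** * Power series on the real axis *)

(* Real coefficients for indices >= 2 only, made into those of an ordinary power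
   series; the values at 0 and 1 of a sequence from [classT] are arbitrary. *)
Definition pad (a : nat -> R) (n : nat) : R :=
  match n with O | 1%nat => 0 | _ => a n end.

Lemma pad_ge_2 (a : nat -> R) (n : nat) : (2 <= n)%nat -> pad a n = a n.
Proof. destruct n as [|[|n]]; [lia | lia | reflexivity]. Qed.

Lemma is_pseries_pad (a : nat -> R) (x s : R) :
  is_pseries (pad a) x s <-> is_series (fun n => a (n + 2)%nat * x ^ (n + 2)) s.
Proof.
rewrite is_pseries_R; split; intros H.
- apply is_series_ext with (fun n => pad a (2 + n)%nat * x ^ (2 + n)).
  { intros n. rewrite Nat.add_comm, pad_ge_2 by lia. reflexivity. }
  apply (is_series_incr_n (fun n => pad a n * x ^ n)); [lia|].
  simpl; rewrite sum_Sn, sum_O; simpl.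
  match goal with |- is_series _ ?t => replace t with s end; [exact H|].
  unfold plus; simpl; ring.
- apply is_series_decr_n with 2%nat; [lia|].
  simpl; rewrite sum_Sn, sum_O; simpl.
  match goal with |- is_series _ ?t => replace t with s end.
  2: unfold plus, opp; simpl; ring.
  revert H; apply is_series_ext; intros n. rewrite Nat.add_comm; reflexivity.
Qed.

Lemma tail_expansion_Re (c : nat -> C) (x : R) (s : C) :
  tail_expansion c (RtoC x) s -> is_pseries (pad (fun n => Re (c n))) x (Re s).
Proof.
intros H; apply is_pseries_pad.
generalize (is_series_Re _ _ H); apply is_series_ext; intros n.
rewrite <- RtoC_pow; unfold Cmult, RtoC, Re; simpl; ring.
Qed.

Lemma tail_expansion_Im (c : nat -> C) (x : R) (s : C) :
  tail_expansion c (RtoC x) s -> is_pseries (pad (fun n => Im (c n))) x (Im s).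
Proof.
intros H; apply is_pseries_pad.
generalize (is_series_Im _ _ H); apply is_series_ext; intros n.
rewrite <- RtoC_pow; unfold Cmult, RtoC, Im; simpl; ring.
Qed.

Lemma CV_radius_ge_1 (a : nat -> R) :
  (forall x, 0 <= x < 1 -> ex_series (fun n => a n * x ^ n)) ->
  Rbar_le 1 (CV_radius a).
Proof.
intros H; apply Rbar_not_lt_le; intros Hlt.
generalize (CV_radius_ge_0 a); intros H0.
assert (Hx : exists x, 0 <= x < 1 /\ Rbar_lt (CV_radius a) x).
{ destruct (CV_radius a) as [r| |]; simpl in *; try tauto.
  exists ((r + 1) / 2); lra. }
destruct Hx as [x [Hx1 Hx2]].
apply (CV_disk_outside a x).
- rewrite Rabs_pos_eq by lra; exact Hx2.
- apply ex_series_lim_0, H, Hx1.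
Qed.

Lemma lt_CV_radius (a : nat -> R) (x : R) :
  Rbar_le 1 (CV_radius a) -> Rabs x < 1 -> Rbar_lt (Rabs x) (CV_radius a).
Proof. intros H Hx; exact (Rbar_lt_le_trans (Rabs x) 1 _ Hx H). Qed.

Lemma is_pseries_CV_radius_ge_1 (a : nat -> R) (f : R -> R) :
  (forall x, Rabs x < 1 -> is_pseries a x (f x)) -> Rbar_le 1 (CV_radius a).
Proof.
intros H; apply CV_radius_ge_1; intros x Hx.
exists (f x); apply is_pseries_R, H; rewrite Rabs_pos_eq; lra.
Qed.

Lemma is_pseries_coeff_unique (a b : nat -> R) (f : R -> R) (n : nat) :
  (forall x, Rabs x < 1 -> is_pseries a x (f x)) ->
  (forall x, Rabs x < 1 -> is_pseries b x (f x)) ->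
  a n = b n.
Proof.
intros Ha Hb.
apply PSeries_ext_recip.
- eapply Rbar_lt_le_trans; [|eapply is_pseries_CV_radius_ge_1, Ha]; simpl; lra.
- eapply Rbar_lt_le_trans; [|eapply is_pseries_CV_radius_ge_1, Hb]; simpl; lra.
- exists (mkposreal 1 Rlt_0_1); intros x Hx.
  assert (Hx' : Rabs x < 1).
  { change (Rabs (x - 0) < 1) in Hx. now rewrite Rminus_0_r in Hx. }
  rewrite (is_pseries_unique _ _ _ (Ha x Hx')), (is_pseries_unique _ _ _ (Hb x Hx')).
  reflexivity.
Qed.

Lemma coeff_eq (phi : C -> C) (d : nat -> C) (n : nat) :
  (forall z : C, disc z -> tail_expansion d z (phi z - z)%C) ->
  (2 <= n)%nat -> coeff phi n = d n.
Proof.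
intros Hd Hn.
assert (Hc : forall z : C, disc z -> tail_expansion (coeff phi) z (phi z - z)%C).
{ unfold coeff; apply epsilon_spec. exists d; exact Hd. }
assert (HR : forall x, Rabs x < 1 -> disc (RtoC x))
  by (intros x Hx; unfold disc; now rewrite Cmod_R).
assert (E1 : pad (fun n => Re (coeff phi n)) n = pad (fun n => Re (d n)) n).
{ apply is_pseries_coeff_unique with (fun x => Re (phi (RtoC x) - RtoC x)%C);
    intros x Hx; apply tail_expansion_Re; auto. }
assert (E2 : pad (fun n => Im (coeff phi n)) n = pad (fun n => Im (d n)) n).
{ apply is_pseries_coeff_unique with (fun x => Im (phi (RtoC x) - RtoC x)%C);
    intros x Hx; apply tail_expansion_Im; auto. }
rewrite !pad_ge_2 in E1, E2 by assumption.
destruct (coeff phi n), (d n); simpl in E1, E2; congruence.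
Qed.

Definition subexponential (m : nat -> R) : Prop :=
  forall t, 0 <= t < 1 -> exists M, forall n, Rabs (m n) * t ^ n <= M.

Lemma subexponential_const (c : R) : subexponential (fun _ => c).
Proof.
intros t Ht; exists (Rabs c); intros n.
assert (H : t ^ n <= 1 ^ n) by (apply pow_incr; lra).
rewrite pow1 in H.
pose proof (Rmult_le_compat_l _ _ _ (Rabs_pos c) H); lra.
Qed.

Lemma subexponential_INR : subexponential INR.
Proof.
intros t Ht.
destruct (Req_dec t 0) as [->|Ht0].
{ exists 0; intros [|n]; simpl; [|right; ring].
  rewrite Rabs_R0; lra. }
set (x := / t - 1).
assert (Hi : t * / t = 1) by (field; assumption).
assert (Hx : 0 < x).
{ unfold x. assert (1 < / t); [|lra].
  rewrite <- Rinv_1; apply Rinv_lt_contravar; lra. }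
exists (/ x); intros n.
rewrite Rabs_pos_eq by apply pos_INR.
assert (B : 1 + INR n * x <= (1 + x) ^ n) by (apply poly; exact Hx).
assert (P : 0 < t ^ n) by (apply pow_lt; lra).
assert (E : (1 + x) ^ n * t ^ n = 1).
{ rewrite <- Rpow_mult_distr. replace ((1 + x) * t) with 1 by (unfold x; lra). apply pow1. }
apply Rmult_le_reg_r with x; [exact Hx|].
rewrite Rinv_l by lra.
assert (B' := Rmult_le_compat_r _ _ _ (Rlt_le _ _ P) B). lra.
Qed.

Lemma subexponential_plus (m m' : nat -> R) :
  subexponential m -> subexponential m' -> subexponential (fun n => m n + m' n).
Proof.
intros H H' t Ht.
destruct (H t Ht) as [M HM]; destruct (H' t Ht) as [M' HM'].
exists (M + M'); intros n.
specialize (HM n); specialize (HM' n).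
assert (P : 0 <= t ^ n) by (apply pow_le; lra).
pose proof (Rmult_le_compat_r _ _ _ P (Rabs_triang (m n) (m' n))); lra.
Qed.

Lemma subexponential_mult (m m' : nat -> R) :
  subexponential m -> subexponential m' -> subexponential (fun n => m n * m' n).
Proof.
intros H H' t Ht.
assert (Hs : 0 <= sqrt t < 1).
{ split; [apply sqrt_pos|]. rewrite <- sqrt_1; apply sqrt_lt_1; lra. }
destruct (H _ Hs) as [M HM]; destruct (H' _ Hs) as [M' HM'].
exists (M * M'); intros n.
assert (P : 0 <= sqrt t ^ n) by (apply pow_le; lra).
rewrite Rabs_mult.
replace (t ^ n) with (sqrt t ^ n * sqrt t ^ n)
  by (rewrite <- Rpow_mult_distr, sqrt_sqrt; [reflexivity | lra]).
replace (Rabs (m n) * Rabs (m' n) * (sqrt t ^ n * sqrt t ^ n))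
  with ((Rabs (m n) * sqrt t ^ n) * (Rabs (m' n) * sqrt t ^ n)) by ring.
apply Rmult_le_compat; auto; apply Rmult_le_pos; auto; apply Rabs_pos.
Qed.

Lemma subexponential_pow (m : nat -> R) (k : nat) :
  subexponential m -> subexponential (fun n => m n ^ k).
Proof.
intros H; induction k as [|k IH]; simpl.
- apply subexponential_const.
- now apply subexponential_mult.
Qed.

Lemma subexponential_le (m m' : nat -> R) :
  (forall n, Rabs (m n) <= Rabs (m' n)) -> subexponential m' -> subexponential m.
Proof.
intros Hle H t Ht; destruct (H t Ht) as [M HM].
exists M; intros n; eapply Rle_trans; [|apply HM].
apply Rmult_le_compat_r; [apply pow_le; lra | apply Hle].
Qed.

Lemma CV_radius_subexponential_mult (m a : nat -> R) :
  subexponential m -> Rbar_le 1 (CV_radius a) ->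
  Rbar_le 1 (CV_radius (fun n => m n * a n)).
Proof.
intros Hm Ha; apply CV_radius_ge_1; intros x Hx.
set (y := (1 + x) / 2).
assert (Hy : 0 < y < 1) by (unfold y; lra).
destruct (Hm (x / y)) as [M HM].
{ split; [apply Rdiv_le_0_compat; lra|].
  apply Rmult_lt_reg_r with y; [lra|]. unfold Rdiv; rewrite Rmult_assoc, Rinv_l by lra.
  unfold y; lra. }
apply (@ex_series_le R_AbsRing R_CompleteNormedModule) with (fun n => M * Rabs (a n * y ^ n)).
- intros n. change (Rabs (m n * a n * x ^ n) <= M * Rabs (a n * y ^ n)).
  replace (m n * a n * x ^ n) with ((m n * (x / y) ^ n) * (a n * y ^ n)).
  + rewrite Rabs_mult. apply Rmult_le_compat_r; [apply Rabs_pos|].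
    rewrite Rabs_mult, (Rabs_pos_eq ((x / y) ^ n)); [apply HM|].
    apply pow_le, Rdiv_le_0_compat; lra.
  + unfold Rdiv. rewrite Rpow_mult_distr, pow_inv. field. apply pow_nonzero; lra.
- apply (@ex_series_scal R_AbsRing R_NormedModule M).
  apply CV_disk_inside, lt_CV_radius; [exact Ha|]. rewrite Rabs_pos_eq; lra.
Qed.

Lemma subexponential_lt_pow (m : nat -> R) (r : R) :
  subexponential m -> 1 < r -> exists n, (2 <= n)%nat /\ m n < r ^ (n - 1).
Proof.
intros Hm Hr.
set (s := sqrt r).
assert (Hs : 1 < s) by (rewrite <- sqrt_1; apply sqrt_lt_1; lra).
assert (Hss : s * s = r) by (apply sqrt_sqrt; lra).
destruct (Hm (/ s)) as [M HM].
{ split; [left; apply Rinv_0_lt_compat; lra|].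
  rewrite <- Rinv_1; apply Rinv_lt_contravar; lra. }
destruct (Pow_x_infinity s) with (b := Rabs M * r + 1) as [N HN].
{ rewrite Rabs_pos_eq; lra. }
exists (N + 2)%nat; split; [lia|].
set (n := (N + 2)%nat).
assert (HNn := HN n ltac:(unfold n; lia)).
assert (P : 0 < s ^ n) by (apply pow_lt; lra).
rewrite Rabs_pos_eq in HNn by lra.
specialize (HM n). rewrite pow_inv in HM.
assert (K : Rabs (m n) <= M * s ^ n).
{ apply Rmult_le_reg_r with (/ s ^ n); [now apply Rinv_0_lt_compat|].
  rewrite Rmult_assoc, Rinv_r by lra. lra. }
apply Rmult_lt_reg_r with r; [lra|].
replace (r ^ (n - 1) * r) with (s ^ n * s ^ n).
2:{ rewrite <- Rpow_mult_distr, Hss. replace n with (S (n - 1)) at 1 by (unfold n; lia).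
    simpl; ring. }
pose proof (Rle_abs (m n)). pose proof (Rle_abs M).
assert (M * s ^ n <= Rabs M * s ^ n) by (apply Rmult_le_compat_r; lra).
assert (m n * r <= Rabs M * s ^ n * r) by (apply Rmult_le_compat_r; lra).
assert (s ^ n * (Rabs M * r + 1) <= s ^ n * s ^ n) by (apply Rmult_le_compat_l; lra).
lra.
Qed.

Lemma is_lim_diff_quotient (f : R -> R) (x l : R) :
  is_derive f x l -> is_lim (fun y => (f y - f x) / (y - x)) x l.
Proof.
intros H; apply is_derive_Reals in H.
apply is_lim_spec; intros eps.
destruct (H eps (cond_pos eps)) as [d Hd].
exists d; intros y Hy Hne.
change (Rabs (y - x) < d) in Hy.
specialize (Hd (y - x) ltac:(lra) Hy).
rewrite Rplus_minus in Hd. exact Hd.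
Qed.

(* [C_derive] is computed from limits along the horizontal line through the point,
   which at a real point is the real axis. *)
Lemma Re_C_derive_real (f : C -> C) (u : R -> R) (x l : R) :
  locally x (fun t => f (RtoC t) = RtoC (u t)) ->
  is_derive u x l -> Re (C_derive f (RtoC x)) = l.
Proof.
intros Hf Hu.
assert (H : is_lim (fun t => fst ((f (t, 0) - f (RtoC x)) / ((t, 0) - RtoC x))%C) x l).
{ apply is_lim_ext_loc with (fun y => (u y - u x) / (y - x)).
  - rewrite (locally_singleton _ _ Hf).
    destruct Hf as [d Hd]; exists d; intros y Hy Hne.
    specialize (Hd y Hy); unfold RtoC at 1 in Hd; rewrite Hd.
    fold (RtoC y). rewrite <- !RtoC_minus, <- RtoC_div by now apply Rminus_eq_contra.
    reflexivity.
  - now apply is_lim_diff_quotient. }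
change (real (Lim (fun t => fst ((f (t, 0) - f (RtoC x)) / ((t, 0) - RtoC x))%C) x) = l).
now rewrite (is_lim_unique _ _ _ H).
Qed.

(** * Weights and the coefficient inequality *)

Lemma pq_bracket_succ (p q : R) (n : nat) :
  p < q -> pq_bracket p q (S n) = p * pq_bracket p q n + q ^ n.
Proof. intros H; unfold pq_bracket; simpl; field; lra. Qed.

Lemma pq_bracket_bounds (p q : R) (n : nat) :
  0 < p -> p < q -> q <= 1 -> 0 <= pq_bracket p q n <= INR n.
Proof.
intros Hp Hpq Hq; induction n as [|n IH].
- unfold pq_bracket; simpl. replace ((1 - 1) / (p - q)) with 0 by (field; lra). lra.
- rewrite pq_bracket_succ, S_INR by assumption.
  assert (0 < q ^ n) by (apply pow_lt; lra).
  assert (q ^ n <= 1) by (rewrite <- (pow1 n); apply pow_incr; lra).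
  nra.
Qed.

Lemma pq_bracket_pos (p q : R) (n : nat) :
  0 < p -> p < q -> q <= 1 -> (1 <= n)%nat -> 0 < pq_bracket p q n.
Proof.
intros Hp Hpq Hq Hn; destruct n as [|n]; [lia|].
rewrite pq_bracket_succ by assumption.
pose proof (pq_bracket_bounds p q n Hp Hpq Hq).
assert (0 < q ^ n) by (apply pow_lt; lra). nra.
Qed.

Definition multiplier (xi kappa : nat) (tau p q : R) (n : nat) : R :=
  pq_bracket p q n ^ kappa * (1 + (INR n - 1) * tau) ^ xi.

Lemma weight_multiplier (xi kappa : nat) (tau eta p q : R) (n : nat) :
  weight xi kappa tau eta p q n =
  (INR n - eta) * ((1 - tau) * multiplier xi kappa tau p q n +
                   tau * multiplier xi (kappa + 1) tau p q n).
Proof. unfold weight, multiplier; rewrite pow_add; ring. Qed.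

Lemma weight_pos (xi kappa : nat) (tau eta p q : R) (n : nat) :
  0 < p -> p < q -> q <= 1 -> 0 <= tau -> eta < 1 ->
  0 < 1 + (pq_bracket p q n - 1) * tau -> (2 <= n)%nat ->
  0 < weight xi kappa tau eta p q n.
Proof.
intros Hp Hpq Hq Ht He Hb Hn.
assert (H2 : 2 <= INR n) by (change 2 with (INR 2); apply le_INR; lia).
unfold weight; repeat apply Rmult_lt_0_compat; try assumption; try lra.
- apply pow_lt, pq_bracket_pos; try assumption; lia.
- apply pow_lt. nra.
Qed.

Lemma subexponential_pq_bracket (p q : R) :
  0 < p -> p < q -> q <= 1 -> subexponential (pq_bracket p q).
Proof.
intros Hp Hpq Hq; apply subexponential_le with INR; [|apply subexponential_INR].
intros n; pose proof (pq_bracket_bounds p q n Hp Hpq Hq).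
rewrite !Rabs_pos_eq; lra.
Qed.

Lemma subexponential_multiplier (xi kappa : nat) (tau p q : R) :
  0 < p -> p < q -> q <= 1 -> subexponential (multiplier xi kappa tau p q).
Proof.
intros Hp Hpq Hq; unfold multiplier.
apply subexponential_mult.
- now apply subexponential_pow, subexponential_pq_bracket.
- apply subexponential_pow with (m := fun n => 1 + (INR n - 1) * tau).
  apply subexponential_plus; [apply subexponential_const|].
  apply (subexponential_mult (fun n => INR n - 1)); [|apply subexponential_const].
  apply (subexponential_plus INR (fun _ => - 1));
    [apply subexponential_INR | apply subexponential_const].
Qed.

Lemma subexponential_weight (xi kappa : nat) (tau eta p q : R) :
  0 < p -> p < q -> q <= 1 -> subexponential (weight xi kappa tau eta p q).
Proof.
intros Hp Hpq Hq.
apply subexponential_le with (fun n => (INR n + - eta) *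
  ((1 - tau) * multiplier xi kappa tau p q n +
   tau * multiplier xi (kappa + 1) tau p q n)).
- intros n; rewrite weight_multiplier; apply Rle_refl.
- apply (subexponential_mult (fun n => INR n + - eta)).
  + apply subexponential_plus; [apply subexponential_INR | apply subexponential_const].
  + apply (subexponential_plus (fun n => (1 - tau) * multiplier xi kappa tau p q n)).
    * apply (subexponential_mult (fun _ => 1 - tau));
        [apply subexponential_const | now apply subexponential_multiplier].
    * apply (subexponential_mult (fun _ => tau));
        [apply subexponential_const | now apply subexponential_multiplier].
Qed.

Definition neg_tail (phi : C -> C) (a : nat -> R) : Prop :=
  forall z : C, disc z -> tail_expansion (fun n => RtoC (a n)) z (z - phi z)%C.

Lemma coeff_neg_tail (phi : C -> C) (a : nat -> R) (n : nat) :
  neg_tail phi a -> (2 <= n)%nat -> coeff phi n = RtoC (- a n).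
Proof.
intros H Hn; apply (coeff_eq phi (fun n => RtoC (- a n))); [|exact Hn].
intros z Hz; unfold tail_expansion.
replace (phi z - z)%C with (@opp C_NormedModule (z - phi z)%C).
2: change ((- (z - phi z))%C = (phi z - z)%C); ring.
generalize (is_series_opp _ _ (H z Hz)); apply is_series_ext; intros k.
change ((- (RtoC (a (k + 2)%nat) * z ^ (k + 2)))%C
        = (RtoC (- a (k + 2)%nat) * z ^ (k + 2))%C).
rewrite RtoC_opp; ring.
Qed.

Lemma neg_tail_is_pseries (phi : C -> C) (a : nat -> R) (x : R) :
  neg_tail phi a -> Rabs x < 1 -> is_pseries (pad a) x (Re (RtoC x - phi (RtoC x))%C).
Proof.
intros H Hx; apply (tail_expansion_Re (fun n => RtoC (a n))), H.
unfold disc; now rewrite Cmod_R.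
Qed.

Lemma CV_radius_neg_tail (phi : C -> C) (a : nat -> R) :
  neg_tail phi a -> Rbar_le 1 (CV_radius (pad a)).
Proof.
intros H; apply is_pseries_CV_radius_ge_1 with (fun x => Re (RtoC x - phi (RtoC x))%C).
intros x Hx; now apply neg_tail_is_pseries.
Qed.

Lemma Upsilon_real (xi kappa : nat) (tau p q : R) (phi : C -> C) (a : nat -> R) (x : R) :
  0 < p -> p < q -> q <= 1 -> neg_tail phi a -> Rabs x < 1 ->
  Upsilon xi kappa tau p q phi (RtoC x) =
  RtoC (x - PSeries (fun n => multiplier xi kappa tau p q n * pad a n) x).
Proof.
intros Hp Hpq Hq H Hx.
set (b := fun n => multiplier xi kappa tau p q n * pad a n).
assert (Hb : is_pseries (pad b) x (PSeries b x)).
{ assert (E : forall n, b n = pad b n).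
  { intros [|[|n]]; [unfold b; simpl; ring | unfold b; simpl; ring | reflexivity]. }
  apply is_pseries_ext with b; [exact E|].
  apply PSeries_correct, CV_radius_inside, lt_CV_radius; [|exact Hx].
  apply CV_radius_subexponential_mult;
    [now apply subexponential_multiplier | now apply CV_radius_neg_tail with phi]. }
apply is_pseries_pad, is_series_opp, is_series_RtoC in Hb.
unfold Upsilon.
rewrite (CSeries_unique _ (RtoC (- PSeries b x))).
- rewrite RtoC_minus, RtoC_opp; ring.
- revert Hb; apply is_series_ext; intros n.
  change (RtoC (- (b (n + 2)%nat * x ^ (n + 2))) =
    (RtoC (multiplier xi kappa tau p q (n + 2)) * coeff phi (n + 2)
     * RtoC x ^ (n + 2))%C).
  rewrite (coeff_neg_tail phi a) by (assumption || lia).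
  unfold b; rewrite pad_ge_2 by lia.
  rewrite <- RtoC_pow, <- !RtoC_mult; f_equal; ring.
Qed.

Lemma PSeries_linear (s t x : R) (a b : nat -> R) :
  Rbar_lt (Rabs x) (CV_radius a) -> Rbar_lt (Rabs x) (CV_radius b) ->
  PSeries (fun n => s * a n + t * b n) x = s * PSeries a x + t * PSeries b x.
Proof.
intros Ha Hb.
rewrite <- !PSeries_scal, <- PSeries_plus.
- reflexivity.
- apply ex_pseries_scal; [apply Rmult_comm | now apply CV_radius_inside].
- apply ex_pseries_scal; [apply Rmult_comm | now apply CV_radius_inside].
Qed.

Lemma Re_div_RtoC (w : C) (d : R) : d <> 0 -> Re (w / RtoC d)%C = Re w / d.
Proof.
intros Hd; destruct w as [u v]; unfold Cdiv, Cmult, Cinv, RtoC, Re; simpl.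
field; assumption.
Qed.

(* A function vanishing at 0 with slope 1 is positive just right of 0, and then
   stays positive as long as it has no zero. *)
Lemma pos_of_no_zero (d d' : R -> R) :
  (forall x, Rabs x < 1 -> is_derive d x (d' x)) ->
  d 0 = 0 -> d' 0 = 1 ->
  (forall x, 0 < x < 1 -> d x <> 0) ->
  forall x, 0 < x < 1 -> 0 < d x.
Proof.
intros Hd H0 H1 Hz x Hx.
destruct (Rlt_le_dec 0 (d x)) as [|Hneg]; [assumption|exfalso].
assert (D0 : derivable_pt_lim d 0 1).
{ rewrite <- H1; apply is_derive_Reals, Hd; rewrite Rabs_R0; lra. }
destruct (D0 (1 / 2) ltac:(lra)) as [del Hdel].
set (h := Rmin (del / 2) (x / 2)).
assert (P := cond_pos del).
assert (Hh0 : 0 < h) by (apply Rmin_glb_lt; lra).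
assert (Hh1 : h <= del / 2) by apply Rmin_l.
assert (Hh2 : h <= x / 2) by apply Rmin_r.
specialize (Hdel h ltac:(lra)).
rewrite Rabs_pos_eq in Hdel by lra.
specialize (Hdel ltac:(lra)).
rewrite Rplus_0_l, H0, Rminus_0_r in Hdel.
apply Rabs_def2 in Hdel.
assert (Hdh : 0 < d h).
{ replace (d h) with (d h / h * h) by (field; lra).
  apply Rmult_lt_0_compat; lra. }
assert (Hx0 : d x < 0) by (specialize (Hz x Hx); lra).
destruct (IVT_interv (fun t => - d t) h x) as [y [Hy Hdy]]; try lra.
- intros t Ht. apply continuity_pt_opp, derivable_continuous_pt.
  exists (d' t); apply is_derive_Reals, Hd. rewrite Rabs_pos_eq; lra.
- apply (Hz y); lra.
Qed.

Lemma sum_n_le_of_powers (g : nat -> R) (M : R) (N : nat) :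
  (forall n, 0 <= g n) ->
  (forall x, 0 < x < 1 -> sum_n (fun n => g n * x ^ n) N <= M) ->
  sum_n g N <= M.
Proof.
intros Hg H.
set (s := sum_n g N).
assert (Hs : 0 <= s).
{ unfold s; rewrite sum_n_Reals; now apply cond_pos_sum. }
assert (K : forall x, 0 < x < 1 -> s * x ^ N <= M).
{ intros x Hx; eapply Rle_trans; [|apply (H x Hx)].
  unfold s; rewrite !sum_n_Reals, Rmult_comm, scal_sum.
  apply sum_Rle; intros n Hn.
  apply Rmult_le_compat_l; [apply Hg|].
  replace N with (n + (N - n))%nat by lia. rewrite pow_add.
  assert (0 < x ^ n) by (apply pow_lt; lra).
  assert (x ^ (N - n) <= 1) by (rewrite <- (pow1 (N - n)); apply pow_incr; lra).
  nra. }
destruct (Rle_lt_dec s M) as [|Hlt]; [assumption|exfalso].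
assert (Hc : continuity_pt (fun x => s * x ^ N) 1) by (apply derivable_continuous_pt; reg).
destruct (Hc (s - M)) as [del [Hdel Hc']]; [lra|].
set (x := 1 - Rmin (del / 2) (1 / 2)).
assert (0 < Rmin (del / 2) (1 / 2)) by (apply Rmin_glb_lt; lra).
assert (Rmin (del / 2) (1 / 2) <= del / 2) by apply Rmin_l.
assert (Rmin (del / 2) (1 / 2) <= 1 / 2) by apply Rmin_r.
specialize (Hc' x); specialize (K x ltac:(unfold x; lra)).
simpl in Hc'; unfold R_dist in Hc'.
assert (Hx : Rabs (s * x ^ N - s * 1 ^ N) < s - M).
{ apply Hc'; split; [split; [exact I | unfold x; lra]|].
  unfold x; rewrite Rabs_left; lra. }
rewrite pow1, Rabs_left1 in Hx; lra.
Qed.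

Lemma classQ_coeff_sum (xi kappa : nat) (tau eta p q : R) (phi : C -> C) (a : nat -> R) (N : nat) :
  0 < p -> p < q -> q <= 1 -> 0 <= tau -> eta < 1 ->
  (forall nu : nat, (2 <= nu)%nat -> 0 < 1 + (pq_bracket p q nu - 1) * tau) ->
  (forall n, 0 <= pad a n) -> neg_tail phi a ->
  classQ xi kappa tau eta p q phi ->
  sum_n (fun n => weight xi kappa tau eta p q n * pad a n) N <= 1 - eta.
Proof.
intros Hp Hpq Hq Ht He1 Hb Ha Hphi [_ HQ].
set (A1 := fun n => multiplier xi kappa tau p q n * pad a n).
set (A2 := fun n => multiplier xi (kappa + 1) tau p q n * pad a n).
set (B := fun n => (1 - tau) * A1 n + tau * A2 n).
assert (Hw : forall n, weight xi kappa tau eta p q n * pad a n = (INR n - eta) * B n).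
{ intros n; rewrite weight_multiplier; unfold B, A1, A2; ring. }
assert (Hg : forall n, 0 <= weight xi kappa tau eta p q n * pad a n).
{ intros n. destruct (Nat.le_gt_cases 2 n) as [Hn|Hn].
  - apply Rmult_le_pos; [|apply Ha]. left; apply weight_pos; auto.
  - replace (pad a n) with 0; [lra|]. destruct n as [|[|n]]; [reflexivity | reflexivity | lia]. }
assert (C0 := CV_radius_neg_tail _ _ Hphi).
assert (C1 : Rbar_le 1 (CV_radius A1))
  by (apply CV_radius_subexponential_mult; [now apply subexponential_multiplier | exact C0]).
assert (C2 : Rbar_le 1 (CV_radius A2))
  by (apply CV_radius_subexponential_mult; [now apply subexponential_multiplier | exact C0]).
assert (CB : Rbar_le 1 (CV_radius B)).
{ apply CV_radius_ge_1; intros x Hx.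
  assert (Hx' : Rabs x < 1) by (rewrite Rabs_pos_eq; lra).
  apply ex_series_ext with (fun n => plus (scal (1 - tau) (A1 n * x ^ n)) (scal tau (A2 n * x ^ n))).
  - intros n; unfold B, plus, scal; simpl; unfold mult; simpl; ring.
  - apply (@ex_series_plus R_AbsRing R_NormedModule);
      apply (@ex_series_scal R_AbsRing R_NormedModule), ex_series_Rabs, CV_disk_inside;
      now apply lt_CV_radius. }
set (d := fun x => x - PSeries B x).
set (d' := fun x => 1 - PSeries (PS_derive B) x).
assert (Dd : forall b x, Rbar_le 1 (CV_radius b) -> Rabs x < 1 ->
  is_derive (fun x => x - PSeries b x) x (1 - PSeries (PS_derive b) x)).
{ intros b x Hcv Hx.
  apply (@is_derive_minus R_AbsRing R_NormedModule (fun x => x)); [apply (@is_derive_id R_AbsRing)|].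
  apply is_derive_PSeries; now apply lt_CV_radius. }
assert (Ld : forall x, Rabs x < 1 ->
  d x = (1 - tau) * (x - PSeries A1 x) + tau * (x - PSeries A2 x)).
{ intros x Hx; unfold d, B; rewrite PSeries_linear by now apply lt_CV_radius. ring. }
assert (Ld' : forall x, Rabs x < 1 ->
  d' x = (1 - tau) * (1 - PSeries (PS_derive A1) x) + tau * (1 - PSeries (PS_derive A2) x)).
{ intros x Hx; unfold d'.
  rewrite (PSeries_ext (PS_derive B)
    (fun n => (1 - tau) * PS_derive A1 n + tau * PS_derive A2 n)).
  - rewrite PSeries_linear by (rewrite CV_radius_derive; now apply lt_CV_radius). ring.
  - intros n; unfold PS_derive, B; ring. }
assert (HD : forall x, Rabs x < 1 ->
  Q_den xi kappa tau p q phi (RtoC x) = RtoC (d x)).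
{ intros x Hx; unfold Q_den.
  rewrite !(Upsilon_real _ _ _ _ _ phi a) by assumption.
  rewrite <- !RtoC_mult, <- RtoC_plus, Ld by assumption. reflexivity. }
assert (HU : forall k x, Rabs x < 1 ->
  Rbar_le 1 (CV_radius (fun n => multiplier xi k tau p q n * pad a n)) ->
  Re (C_derive (Upsilon xi k tau p q phi) (RtoC x)) =
  1 - PSeries (PS_derive (fun n => multiplier xi k tau p q n * pad a n)) x).
{ intros k x Hx Hcv.
  apply Re_C_derive_real with
    (fun x => x - PSeries (fun n => multiplier xi k tau p q n * pad a n) x).
  - assert (Hpos : 0 < 1 - Rabs x) by lra.
    exists (mkposreal _ Hpos); intros y Hy.
    apply Upsilon_real; try assumption.
    change (Rabs (y - x) < 1 - Rabs x) in Hy.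
    replace y with (x + (y - x)) by apply Rplus_minus.
    eapply Rle_lt_trans; [apply Rabs_triang | lra].
  - now apply Dd. }
assert (HN : forall x, Rabs x < 1 ->
  Re (Q_num xi kappa tau p q phi (RtoC x)) = x * d' x).
{ intros x Hx; rewrite Ld' by assumption; unfold A1, A2.
  rewrite <- !HU by assumption.
  unfold Q_num, Cmult, Cplus, RtoC, Re; simpl; ring. }
assert (HQ' : forall x, 0 < x < 1 -> d x <> 0 /\ x * d' x / d x > eta).
{ intros x Hx.
  assert (Hx' : Rabs x < 1) by (rewrite Rabs_pos_eq; lra).
  destruct (HQ (RtoC x)) as [HQ1 HQ2].
  - unfold disc; now rewrite Cmod_R.
  - intros E; apply RtoC_inj in E; lra.
  - rewrite HD in HQ1, HQ2 by assumption.
    assert (Hd0 : d x <> 0) by (intros E; apply HQ1; now rewrite E).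
    rewrite Re_div_RtoC, HN in HQ2 by assumption. now split. }
assert (Hpos : forall x, 0 < x < 1 -> 0 < d x).
{ apply pos_of_no_zero with d'.
  - intros x Hx; now apply Dd.
  - unfold d; rewrite PSeries_0; unfold B, A1, A2; simpl; ring.
  - unfold d'; rewrite PSeries_0; unfold PS_derive, B, A1, A2; simpl; ring.
  - intros x Hx; now apply HQ'. }
apply sum_n_le_of_powers; [exact Hg|].
intros x Hx.
assert (Hx' : Rabs x < 1) by (rewrite Rabs_pos_eq; lra).
assert (S1 : is_pseries (fun n => INR n * B n) x (x * PSeries (PS_derive B) x)).
{ apply is_pseries_ext with (PS_incr_1 (PS_derive B)).
  - intros [|n]; [symmetry; apply Rmult_0_l | reflexivity].
  - apply (is_pseries_incr_1 (PS_derive B)), PSeries_correct, CV_radius_inside.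
    rewrite CV_radius_derive; now apply lt_CV_radius. }
assert (S2 : is_pseries B x (PSeries B x))
  by (apply PSeries_correct, CV_radius_inside; now apply lt_CV_radius).
apply is_pseries_R in S1; apply is_pseries_R in S2.
assert (S3 : is_series (fun n => (weight xi kappa tau eta p q n * pad a n) * x ^ n)
               (x * PSeries (PS_derive B) x - eta * PSeries B x)).
{ generalize (is_series_minus _ _ _ _ S1
    (@is_series_scal R_AbsRing R_NormedModule eta _ _ S2)).
  apply is_series_ext; intros n; rewrite Hw.
  unfold plus, opp, scal; simpl; unfold mult; simpl; ring. }
assert (Hlim : x * PSeries (PS_derive B) x - eta * PSeries B x <= (1 - eta) * x).
{ destruct (HQ' x Hx) as [_ HQx].
  assert (K : eta * d x < x * d' x).
  { replace (x * d' x) with (x * d' x / d x * d x) by (field; now apply HQ').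
    apply Rmult_lt_compat_r; [now apply Hpos | exact HQx]. }
  unfold d, d' in K. lra. }
apply Rle_trans with ((1 - eta) * x); [|nra].
eapply Rle_trans; [|exact Hlim].
rewrite sum_n_Reals; apply sum_incr; [now apply is_series_Reals|].
intros n; apply Rmult_le_pos; [apply Hg | apply pow_le; lra].
Qed.

(** * The radius and the extremal functions *)

Lemma sum_n_shift2 (g : nat -> R) (N : nat) :
  g 0%nat = 0 -> g 1%nat = 0 -> sum_n (fun k => g (k + 2)%nat) N = sum_n g (N + 2).
Proof.
intros H0 H1; induction N as [|N IH].
- simpl. rewrite !sum_Sn, !sum_O, H0, H1. unfold plus; simpl; ring.
- simpl. rewrite !sum_Sn, IH. reflexivity.
Qed.

Lemma is_series_le_bound (a : nat -> R) (l M : R) :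
  is_series a l -> (forall N, sum_n a N <= M) -> l <= M.
Proof.
intros Ha H.
exact (is_lim_seq_le (sum_n a) (fun _ => M) l M H Ha (is_lim_seq_const M)).
Qed.

(* Since |w^n - z^n| <= n r^(n-1) |w - z| for |z|, |w| <= r, the map z |-> z - phi z
   is s-Lipschitz there; this replaces termwise differentiation. *)
Lemma Re_C_derive_ge (phi : C -> C) (a : nat -> R) (r s : R) (z : C) :
  neg_tail phi a -> (forall n, 0 <= pad a n) ->
  (forall N, sum_n (fun n => INR n * r ^ (n - 1) * pad a n) N <= s) ->
  Cmod z < r -> r <= 1 ->
  @ex_derive C_AbsRing C_NormedModule phi z ->
  1 - s <= Re (C_derive phi z).
Proof.
intros Hphi Ha Hs Hz Hr Hd.
apply C_derive_correct in Hd; [|exact z].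
set (l := C_derive phi z) in *.
destruct (Rle_lt_dec (1 - s) (Re l)) as [|Hlt]; [assumption|exfalso].
destruct (proj1 (is_C_derive_eps _ _ _) Hd ((1 - s - Re l) / 2)) as [d [Hd0 Hd']]; [lra|].
set (h := Rmin (d / 2) ((r - Cmod z) / 2)).
assert (Hh0 : 0 < h) by (apply Rmin_glb_lt; lra).
assert (Hh1 : h <= d / 2) by apply Rmin_l.
assert (Hh2 : h <= (r - Cmod z) / 2) by apply Rmin_r.
set (w := (z + RtoC h)%C).
assert (Ewz : (w - z)%C = RtoC h) by (unfold w; ring).
assert (Hwz : Cmod (w - z) = h) by (rewrite Ewz, Cmod_R, Rabs_pos_eq; lra).
assert (Hw : Cmod w < r).
{ unfold w; eapply Rle_lt_trans; [apply Cmod_triangle|].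
  rewrite Cmod_R, Rabs_pos_eq; lra. }
specialize (Hd' w ltac:(lra)).
rewrite Hwz in Hd'.
apply (Rle_trans _ _ _ (re_le_Cmod _)) in Hd'.
apply Rabs_le_between in Hd'; destruct Hd' as [_ Hd'].
replace (Re (phi w - phi z - l * (w - z))%C)
  with (h - Re ((w - phi w) - (z - phi z))%C - Re l * h) in Hd'.
2:{ rewrite Ewz; unfold w, Cminus, Cplus, Copp, Cmult, RtoC, Re; simpl; ring. }
assert (Hser : Re ((w - phi w) - (z - phi z))%C <= s * h).
{ apply is_series_le_bound with
    (fun n => Re ((RtoC (a (n + 2)%nat) * w ^ (n + 2)) - (RtoC (a (n + 2)%nat) * z ^ (n + 2)))%C).
  - apply (is_series_Re (fun n => (RtoC (a (n + 2)%nat) * w ^ (n + 2)) -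
      (RtoC (a (n + 2)%nat) * z ^ (n + 2)))%C).
    apply (@is_series_minus C_AbsRing C_NormedModule
      (fun n => RtoC (a (n + 2)%nat) * w ^ (n + 2))%C
      (fun n => RtoC (a (n + 2)%nat) * z ^ (n + 2))%C);
      apply Hphi; unfold disc; lra.
  - intros N.
    apply Rle_trans with (h * sum_n (fun n => INR n * r ^ (n - 1) * pad a n) (N + 2)).
    2:{ rewrite (Rmult_comm s); apply Rmult_le_compat_l; [lra | apply Hs]. }
    rewrite <- sum_n_shift2 by (simpl; ring).
    rewrite !sum_n_Reals, scal_sum; apply sum_Rle; intros n _.
    specialize (Ha (n + 2)%nat); rewrite pad_ge_2 in Ha |- * by lia.
    eapply Rle_trans; [apply Rle_abs|].
    eapply Rle_trans; [apply re_le_Cmod|].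
    replace (RtoC (a (n + 2)%nat) * w ^ (n + 2) - RtoC (a (n + 2)%nat) * z ^ (n + 2))%C
      with (RtoC (a (n + 2)%nat) * (w ^ (n + 2) - z ^ (n + 2)))%C by ring.
    rewrite Cmod_mult, Cmod_R, Rabs_pos_eq by assumption.
    replace (n + 2 - 1)%nat with (S n) by lia.
    replace (n + 2)%nat with (S (S n)) in * by lia.
    pose proof (Cpow_sub_bound z w r (S n) ltac:(lra) ltac:(lra)) as K.
    rewrite Hwz in K.
    apply (Rmult_le_compat_l _ _ _ Ha) in K. lra. }
nra.
Qed.

Definition radicand (xi kappa : nat) (tau eta rho p q : R) (n : nat) : R :=
  (1 - rho) * / INR n * weight xi kappa tau eta p q n / (1 - eta).

Lemma Rpower_root_pow (a : R) (n : nat) :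
  0 < a -> (2 <= n)%nat -> Rpower a (1 / (INR n - 1)) ^ (n - 1) = a.
Proof.
intros Ha Hn.
assert (H2 : 2 <= INR n) by (change 2 with (INR 2); apply le_INR; lia).
rewrite <- Rpower_pow by apply exp_pos.
rewrite Rpower_mult, minus_INR by lia; simpl (INR 1).
replace (1 / (INR n - 1) * (INR n - 1)) with 1 by (field; lra).
now apply Rpower_1.
Qed.

Lemma r1_is_glb (xi kappa : nat) (tau eta rho p q : R) :
  let root n := Rpower (radicand xi kappa tau eta rho p q n) (1 / (INR n - 1)) in
  (forall n, (2 <= n)%nat -> r1 xi kappa tau eta rho p q <= root n) /\
  (forall r, r1 xi kappa tau eta rho p q < r -> exists n, (2 <= n)%nat /\ root n < r).
Proof.
intros root.
set (E := fun x => exists nu : nat, (2 <= nu)%nat /\ x = root nu).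
destruct (Glb_Rbar_correct E) as [Hlb Hglb].
change (r1 xi kappa tau eta rho p q) with (real (Glb_Rbar E)).
assert (H2 : E (root 2%nat)) by (exists 2%nat; split; [lia | reflexivity]).
assert (H0 : Rbar_le 0 (Glb_Rbar E)).
{ apply Hglb; intros x [n [_ ->]]; apply Rlt_le, exp_pos. }
assert (Hfin := Hlb _ H2).
destruct (Glb_Rbar E) as [g| |]; simpl in Hfin, H0; try tauto.
split.
- intros n Hn; apply (Hlb (root n)); now exists n.
- intros r Hr; simpl in Hr.
  destruct (Classical_Prop.classic (exists n, (2 <= n)%nat /\ root n < r)) as [|Hno];
    [assumption|exfalso].
  assert (K : Rbar_le r g).
  { apply Hglb; intros x [n [Hn ->]]; simpl.
    destruct (Rle_lt_dec r (root n)); [assumption|].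
    exfalso; apply Hno; now exists n. }
  simpl in K; lra.
Qed.

Lemma r1_pow_le_radicand (xi kappa : nat) (tau eta rho p q : R) (n : nat) :
  0 <= r1 xi kappa tau eta rho p q -> (2 <= n)%nat ->
  0 < radicand xi kappa tau eta rho p q n ->
  r1 xi kappa tau eta rho p q ^ (n - 1) <= radicand xi kappa tau eta rho p q n.
Proof.
intros H0 Hn Hr.
rewrite <- (Rpower_root_pow _ n Hr Hn).
apply pow_incr; split; [exact H0 | now apply r1_is_glb].
Qed.

Lemma radicand_pos (xi kappa : nat) (tau eta rho p q : R) (n : nat) :
  rho < 1 -> eta < 1 -> (2 <= n)%nat -> 0 < weight xi kappa tau eta p q n ->
  0 < radicand xi kappa tau eta rho p q n.
Proof.
intros Hr He Hn Hw.
apply Rdiv_lt_0_compat; [|lra].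
apply Rmult_lt_0_compat; [apply Rmult_lt_0_compat; [lra|] | exact Hw].
apply Rinv_0_lt_compat, lt_0_INR; lia.
Qed.

(* The radicands grow at most polynomially, so their (n-1)-th roots have upper
   limit at most 1: the radius never leaves the disc. *)
Lemma r1_le_1 (xi kappa : nat) (tau eta rho p q : R) :
  0 < p -> p < q -> q <= 1 -> eta < 1 -> rho < 1 ->
  (forall n, (2 <= n)%nat -> 0 < weight xi kappa tau eta p q n) ->
  r1 xi kappa tau eta rho p q <= 1.
Proof.
intros Hp Hpq Hq He Hr Hw.
destruct (Rle_lt_dec (r1 xi kappa tau eta rho p q) 1) as [|Hlt]; [assumption|exfalso].
destruct (subexponential_lt_pow
  (fun n => (1 - rho) / (1 - eta) * weight xi kappa tau eta p q n)
  (r1 xi kappa tau eta rho p q))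
  as [n [Hn K]].
{ apply (subexponential_mult (fun _ => (1 - rho) / (1 - eta)));
    [apply subexponential_const | now apply subexponential_weight]. }
{ exact Hlt. }
specialize (Hw n Hn).
assert (K' := r1_pow_le_radicand xi kappa tau eta rho p q n ltac:(lra) Hn
  ltac:(now apply radicand_pos)).
assert (H1 : 1 <= INR n) by (change 1 with (INR 1); apply le_INR; lia).
assert (H2 : / INR n <= 1) by (rewrite <- Rinv_1; apply Rinv_le_contravar; lra).
assert (P : 0 < (1 - rho) / (1 - eta) * weight xi kappa tau eta p q n).
{ apply Rmult_lt_0_compat; [apply Rdiv_lt_0_compat; lra | exact Hw]. }
assert (E : radicand xi kappa tau eta rho p q n =
  (1 - rho) / (1 - eta) * weight xi kappa tau eta p q n * / INR n).
{ unfold radicand; field; split; lra. }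
assert (K2 := Rmult_le_compat_l _ _ _ (Rlt_le _ _ P) H2).
lra.
Qed.

Lemma classP_close_to_convex (xi kappa : nat) (tau eta rho p q : R) (phi : C -> C) :
  0 < p -> p < q -> q <= 1 -> 0 <= tau -> eta < 1 -> rho < 1 ->
  (forall nu : nat, (2 <= nu)%nat -> 0 < 1 + (pq_bracket p q nu - 1) * tau) ->
  classP xi kappa tau eta p q phi ->
  close_to_convex rho (r1 xi kappa tau eta rho p q) phi.
Proof.
intros Hp Hpq Hq Ht He1 Hr1 Hb [HQ [HA [a [Ha0 Ha]]]] z Hz.
assert (Hw : forall n, (2 <= n)%nat -> 0 < weight xi kappa tau eta p q n)
  by (intros n Hn; apply weight_pos; auto).
assert (Hle := r1_le_1 xi kappa tau eta rho p q Hp Hpq Hq He1 Hr1 Hw).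
assert (Hrad : forall n, (2 <= n)%nat -> 0 < radicand xi kappa tau eta rho p q n)
  by (intros n Hn; apply radicand_pos; auto).
set (R1 := r1 xi kappa tau eta rho p q) in *.
assert (Hpad : forall n, 0 <= pad a n)
  by (intros [|[|n]]; [simpl; lra | simpl; lra | apply Ha0; lia]).
pose proof (Cmod_ge_0 z) as Hz0.
assert (Hex : @ex_derive C_AbsRing C_NormedModule phi z)
  by (apply HA; unfold disc; lra).
split; [exact Hex|].
set (r := (Cmod z + R1) / 2).
set (t := r / R1).
assert (Ht0 : 0 < t) by (apply Rdiv_lt_0_compat; unfold r; lra).
assert (Ht1 : t < 1).
{ apply Rmult_lt_reg_r with R1; [lra|]. replace (t * R1) with r by (unfold t; field; lra).
  unfold r; lra. }
assert (Hge : 1 - t * (1 - rho) <= Re (C_derive phi z)).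
{ apply Re_C_derive_ge with a r; try assumption; try (unfold r; lra).
  intros N.
  apply Rle_trans with (t * (1 - rho) / (1 - eta) *
    sum_n (fun n => weight xi kappa tau eta p q n * pad a n) N).
  - rewrite !sum_n_Reals, scal_sum; apply sum_Rle; intros n _.
    destruct (Nat.le_gt_cases 2 n) as [Hn|Hn].
    2:{ replace (pad a n) with 0; [lra|].
        destruct n as [|[|n]]; [reflexivity | reflexivity | lia]. }
    assert (HnP : 0 < INR n) by (apply lt_0_INR; lia).
    assert (K := r1_pow_le_radicand xi kappa tau eta rho p q n
      ltac:(fold R1; lra) Hn (Hrad n Hn)).
    fold R1 in K.
    assert (Hrn : r ^ (n - 1) <= t * radicand xi kappa tau eta rho p q n).
    { replace r with (t * R1) by (unfold t; field; lra).
      rewrite Rpow_mult_distr.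
      apply Rmult_le_compat; try (apply pow_le; lra); [|exact K].
      replace (n - 1)%nat with (S (n - 2)) by lia. simpl.
      assert (t ^ (n - 2) <= 1) by (rewrite <- (pow1 (n - 2)); apply pow_incr; lra).
      nra. }
    apply (Rmult_le_compat_l (INR n)) in Hrn; [|lra].
    replace (weight xi kappa tau eta p q n * pad a n * (t * (1 - rho) / (1 - eta)))
      with (INR n * (t * radicand xi kappa tau eta rho p q n) * pad a n)
      by (unfold radicand; field; lra).
    apply Rmult_le_compat_r; [apply Hpad | exact Hrn].
  - replace (t * (1 - rho)) with (t * (1 - rho) / (1 - eta) * (1 - eta)) at 2 by (field; lra).
    apply Rmult_le_compat_l.
    + apply Rdiv_le_0_compat; [apply Rmult_le_pos|]; lra.
    + apply classQ_coeff_sum with phi; assumption. }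
nra.
Qed.

Lemma is_C_derive_extremal (xi kappa : nat) (tau eta p q : R) (nu : nat) (z : C) :
  @is_derive C_AbsRing C_NormedModule (extremal xi kappa tau eta p q nu) z
    (1 - RtoC ((1 - eta) / weight xi kappa tau eta p q nu) * INR nu * z ^ (nu - 1))%C.
Proof. apply is_C_derive_id_sub_monomial. Qed.

Definition single (nu : nat) (b : R) (n : nat) : R := if Nat.eq_dec n nu then b else 0.

Lemma is_series_single_shift (nu : nat) (f : nat -> C) :
  (2 <= nu)%nat -> (forall n, n <> nu -> f n = RtoC 0) ->
  @is_series C_AbsRing C_NormedModule (fun n => f (n + 2)%nat) (f nu).
Proof.
intros Hnu H.
assert (K := @is_series_single C_AbsRing C_NormedModule (fun n => f (n + 2)%nat) (nu - 2)).
cbv beta in K; replace (nu - 2 + 2)%nat with nu in K by lia.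
apply K; intros n Hn; apply H; lia.
Qed.

Lemma neg_tail_extremal (xi kappa : nat) (tau eta p q : R) (nu : nat) :
  (2 <= nu)%nat ->
  neg_tail (extremal xi kappa tau eta p q nu)
    (single nu ((1 - eta) / weight xi kappa tau eta p q nu)).
Proof.
intros Hnu z _; unfold tail_expansion, extremal.
set (b := (1 - eta) / weight xi kappa tau eta p q nu).
replace (z - (z - RtoC b * z ^ nu))%C with (RtoC (single nu b nu) * z ^ nu)%C.
- apply (is_series_single_shift nu (fun n => RtoC (single nu b n) * z ^ n)%C Hnu).
  intros n Hn; unfold single; destruct (Nat.eq_dec n nu); [contradiction | ring].
- unfold single; destruct (Nat.eq_dec nu nu); [ring | contradiction].
Qed.

Lemma Upsilon_extremal (xi kappa k : nat) (tau eta p q : R) (nu : nat) (z : C) :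
  (2 <= nu)%nat ->
  Upsilon xi k tau p q (extremal xi kappa tau eta p q nu) z =
  (z - RtoC (multiplier xi k tau p q nu * ((1 - eta) / weight xi kappa tau eta p q nu))
       * z ^ nu)%C.
Proof.
intros Hnu; unfold Upsilon.
set (b := (1 - eta) / weight xi kappa tau eta p q nu).
set (f := fun n => (RtoC (multiplier xi k tau p q n * - single nu b n) * z ^ n)%C).
rewrite (CSeries_unique _ (f nu)).
- unfold f, single; destruct (Nat.eq_dec nu nu); [|contradiction].
  rewrite !RtoC_mult, RtoC_opp; ring.
- apply is_series_ext with (fun n => f (n + 2)%nat).
  + intros n; unfold f.
    rewrite (coeff_neg_tail _ _ (n + 2) (neg_tail_extremal xi kappa tau eta p q nu Hnu)) by lia.
    rewrite RtoC_mult; reflexivity.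
  + apply is_series_single_shift; [exact Hnu|].
    intros n Hn; unfold f, single; destruct (Nat.eq_dec n nu); [contradiction|].
    rewrite Ropp_0, Rmult_0_r; ring.
Qed.

Lemma C_derive_Upsilon_extremal (xi kappa k : nat) (tau eta p q : R) (nu : nat) (z : C) :
  (2 <= nu)%nat ->
  C_derive (Upsilon xi k tau p q (extremal xi kappa tau eta p q nu)) z =
  (1 - RtoC (multiplier xi k tau p q nu * ((1 - eta) / weight xi kappa tau eta p q nu))
       * INR nu * z ^ (nu - 1))%C.
Proof.
intros Hnu; apply is_C_derive_unique.
eapply is_derive_ext; [|apply is_C_derive_id_sub_monomial].
intros w; symmetry; now apply Upsilon_extremal.
Qed.

Lemma Re_quotient_gt (eta beta m : R) (u : C) :
  eta < 1 -> 1 <= m -> (m - eta) * beta = 1 - eta -> Cmod u < 1 ->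
  (1 - RtoC beta * u)%C <> RtoC 0 /\
  Re ((1 - RtoC (m * beta) * u) / (1 - RtoC beta * u))%C > eta.
Proof.
intros He Hm Hbeta Hu.
pose proof (Cmod_ge_0 u) as Hu0.
assert (Hb0 : 0 < beta) by nra.
assert (Hb1 : beta <= 1) by nra.
assert (Hbu : Cmod (RtoC beta * u) = beta * Cmod u)
  by (rewrite Cmod_mult, Cmod_R, Rabs_pos_eq; lra).
assert (Hden : 1 - beta * Cmod u <= Cmod (1 - RtoC beta * u)).
{ assert (K : Cmod 1 <= Cmod (1 - RtoC beta * u) + Cmod (RtoC beta * u)).
  { replace (RtoC 1) with ((1 - RtoC beta * u) + RtoC beta * u)%C at 1 by ring.
    apply Cmod_triangle. }
  rewrite Cmod_1, Hbu in K; lra. }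
assert (Hbu1 : beta * Cmod u < 1) by nra.
assert (Hne : (1 - RtoC beta * u)%C <> RtoC 0) by (apply Cmod_gt_0; lra).
split; [exact Hne|].
replace ((1 - RtoC (m * beta) * u) / (1 - RtoC beta * u))%C
  with (1 - RtoC ((m - 1) * beta) * u / (1 - RtoC beta * u))%C.
2:{ rewrite !RtoC_mult, RtoC_minus. field. exact Hne. }
set (v := (RtoC ((m - 1) * beta) * u / (1 - RtoC beta * u))%C).
assert (Hv : Cmod v < 1 - eta).
{ unfold v; rewrite Cmod_div, Cmod_mult, Cmod_R, Rabs_pos_eq by (assumption || nra).
  apply Rmult_lt_reg_r with (Cmod (1 - RtoC beta * u)); [lra|].
  unfold Rdiv; rewrite Rmult_assoc, Rinv_l by lra.
  apply Rlt_le_trans with ((1 - eta) * (1 - beta * Cmod u)).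
  - nra.
  - apply Rmult_le_compat_l; lra. }
replace (Re (1 - v)%C) with (1 - Re v) by (unfold Cminus, Cplus, Copp, Re; simpl; ring).
pose proof (re_le_Cmod v); pose proof (Rle_abs (Re v)); lra.
Qed.

Lemma classP_extremal (xi kappa : nat) (tau eta p q : R) (nu : nat) :
  eta < 1 -> (2 <= nu)%nat -> 0 < weight xi kappa tau eta p q nu ->
  classP xi kappa tau eta p q (extremal xi kappa tau eta p q nu).
Proof.
intros He Hnu Hw.
assert (H2 : 2 <= INR nu) by (change 2 with (INR 2); apply le_INR; lia).
assert (HA : classA (extremal xi kappa tau eta p q nu)).
{ repeat split.
  - intros z _; eexists; apply is_C_derive_extremal.
  - unfold extremal. replace nu with (S (nu - 1)) at 2 by lia. rewrite Cpow_S; ring.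
  - rewrite (is_C_derive_unique _ _ _ (is_C_derive_extremal _ _ _ _ _ _ _ _)).
    replace (nu - 1)%nat with (S (nu - 2)) by lia. rewrite Cpow_S; ring. }
split; [split; [exact HA|] | split; [exact HA|]].
- intros z Hz Hz0.
  set (b := (1 - eta) / weight xi kappa tau eta p q nu).
  set (c := (1 - tau) * multiplier xi kappa tau p q nu +
            tau * multiplier xi (kappa + 1) tau p q nu).
  set (u := (z ^ (nu - 1))%C).
  assert (Ezn : (z ^ nu)%C = (z * u)%C).
  { unfold u; rewrite <- Cpow_S; f_equal; lia. }
  assert (Eden : Q_den xi kappa tau p q (extremal xi kappa tau eta p q nu) z =
                 (z * (1 - RtoC (c * b) * u))%C).
  { unfold Q_den; rewrite !Upsilon_extremal by assumption; fold b; rewrite Ezn.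
    unfold c; rewrite !RtoC_mult, RtoC_plus, !RtoC_mult, RtoC_minus; ring. }
  assert (Enum : Q_num xi kappa tau p q (extremal xi kappa tau eta p q nu) z =
                 (z * (1 - RtoC (INR nu * (c * b)) * u))%C).
  { unfold Q_num; rewrite !C_derive_Upsilon_extremal by assumption; fold b; fold u.
    unfold c; rewrite !RtoC_mult, RtoC_plus, !RtoC_mult, RtoC_minus; ring. }
  destruct (Re_quotient_gt eta (c * b) (INR nu) u) as [Q1 Q2]; try lra.
  + rewrite weight_multiplier in Hw; fold c in Hw.
    unfold b; rewrite weight_multiplier; fold c.
    field; split; [|lra]. intros E; rewrite E in Hw; lra.
  + unfold u; rewrite Cmod_pow.
    replace (nu - 1)%nat with (S (nu - 2)) by lia; simpl.
    unfold disc in Hz; pose proof (Cmod_ge_0 z).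
    assert (Cmod z ^ (nu - 2) <= 1) by (rewrite <- (pow1 (nu - 2)); apply pow_incr; lra).
    assert (0 <= Cmod z ^ (nu - 2)) by (apply pow_le; lra).
    nra.
  + rewrite Eden, Enum; split.
    * now apply Cmult_neq_0.
    * replace (z * (1 - RtoC (INR nu * (c * b)) * u) / (z * (1 - RtoC (c * b) * u)))%C
        with ((1 - RtoC (INR nu * (c * b)) * u) / (1 - RtoC (c * b) * u))%C
        by (field; now split).
      exact Q2.
- exists (single nu ((1 - eta) / weight xi kappa tau eta p q nu)); split.
  + intros n _; unfold single; destruct (Nat.eq_dec n nu); [|lra].
    apply Rdiv_le_0_compat; lra.
  + now apply neg_tail_extremal.
Qed.

Lemma Re_C_derive_extremal_root (xi kappa : nat) (tau eta rho p q : R) (nu : nat) (x : R) :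
  eta < 1 -> (2 <= nu)%nat -> 0 < weight xi kappa tau eta p q nu ->
  x ^ (nu - 1) = radicand xi kappa tau eta rho p q nu ->
  Re (C_derive (extremal xi kappa tau eta p q nu) (RtoC x)) = rho.
Proof.
intros He Hnu Hw Hx.
assert (HnP : 0 < INR nu) by (apply lt_0_INR; lia).
rewrite (is_C_derive_unique _ _ _ (is_C_derive_extremal _ _ _ _ _ _ _ _)).
rewrite <- RtoC_pow, <- !RtoC_mult, <- RtoC_minus, Hx.
change (1 - (1 - eta) / weight xi kappa tau eta p q nu * INR nu *
  radicand xi kappa tau eta rho p q nu = rho).
unfold radicand; field; repeat split; lra.
Qed.

Theorem theorem6p1 :
  forall (p q tau eta rho : R) (kappa xi : nat),
    0 < p -> p < q -> q <= 1 ->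
    0 <= tau ->
    0 <= eta -> eta < 1 ->
    0 <= rho -> rho < 1 ->
    (* The radius is an infimum of real roots of the radicands, and the extremal
       functions divide by the weights. Both make sense for every nu exactly
       when this factor is positive, i.e. when tau <= 1 or q = 1; for tau > 1
       and q < 1 it is negative for all large nu, as [nu]_{p,q} tends to 0. *)
    (forall nu : nat, (2 <= nu)%nat -> 0 < 1 + (pq_bracket p q nu - 1) * tau) ->
    (forall phi : C -> C,
       classP xi kappa tau eta p q phi ->
       close_to_convex rho (r1 xi kappa tau eta rho p q) phi) /\
    (* sharpness, with the extremal functions as witnesses *)
    (forall nu : nat, (2 <= nu)%nat ->
       classP xi kappa tau eta p q (extremal xi kappa tau eta p q nu)) /\
    (forall r : R, r1 xi kappa tau eta rho p q < r ->
       exists nu : nat, (2 <= nu)%nat /\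
         ~ close_to_convex rho r (extremal xi kappa tau eta p q nu)).
Proof.
intros p q tau eta rho kappa xi Hp Hpq Hq Ht He0 He1 Hr0 Hr1 Hb.
assert (Hw : forall n, (2 <= n)%nat -> 0 < weight xi kappa tau eta p q n)
  by (intros n Hn; apply weight_pos; auto).
split; [|split].
- intros phi Hphi; now apply classP_close_to_convex.
- intros nu Hnu; apply classP_extremal; auto.
- intros r Hr.
  destruct (proj2 (r1_is_glb xi kappa tau eta rho p q) r Hr) as [nu [Hnu Hlt]].
  exists nu; split; [exact Hnu|]; intros Hctc.
  set (x := Rpower (radicand xi kappa tau eta rho p q nu) (1 / (INR nu - 1))) in Hlt.
  destruct (Hctc (RtoC x)) as [_ K].
  + rewrite Cmod_R, Rabs_pos_eq; [exact Hlt | apply Rlt_le, exp_pos].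
  + rewrite (Re_C_derive_extremal_root xi kappa tau eta rho) in K; auto; [lra|].
    apply Rpower_root_pow; [apply radicand_pos; auto | exact Hnu].
Qed.
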